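(* Let $\mathbb{H}\subset\mathbb{N}$ be such that the asymptotic density $\mathcal{D}(\mathbb{H})$ exists, $\mathcal{D}(\mathbb{H})>0$, and $\mathcal{D}(\mathbb{N}\setminus\mathbb{H})<\frac12\mathcal{D}(\mathbb{H})$. Let $$r_{\mathbb{H}}(n):=\#\{(a,b)\in\mathbb{H}^2 : a+b=n\}.$$ Then $\lim_{n\to\infty}r_{\mathbb{H}}(n)=\infty$.
   Context: $\mathbb{N}=\{1,2,\dots\}$, $\mathbb{N}_n=\{1,\dots,n\}$, and for $\mathbb{S}\subset\mathbb{N}$ the asymptotic density is $\mathcal{D}(\mathbb{S})=\lim_{n\to\infty}|\mathbb{S}\cap\mathbb{N}_n|/n$ when the limit exists. *)

(* Defs.v *)
From HB Require Import structures.
From mathcomp Require Import all_boot all_order all_algebra finmap.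
From mathcomp Require Import all_classical all_reals all_analysis.
Import Order.TTheory GRing.Theory Num.Theory.
Import numFieldNormedType.Exports.

Set Implicit Arguments.
Unset Strict Implicit.
Unset Printing Implicit Defensive.

Local Open Scope classical_set_scope.
Local Open Scope ring_scope.

Definition posnat : set nat := [set k | (0 < k)%N].

Definition initial_posnat (n : nat) : set nat := [set k | (1 <= k <= n)%N].

(* [fset_set] is meaningful only on finite sets; see
   [finite_initial_posnat] and [finite_sum_pairs] below. *)
Definition counting_function (S : set nat) (n : nat) : nat :=
  #|` fset_set (S `&` initial_posnat n)|.

(* The value at n = 0 is 0 / 0 = 0 and does not affect the limit. *)
Definition density_seq (R : realType) (S : set nat) : R^nat :=
  fun n => (counting_function S n)%:R / n%:R.

Definition has_asymptotic_density (R : realType) (S : set nat) : Prop :=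
  cvgn (density_seq R S).

(* An unspecified value when [has_asymptotic_density R S] fails. *)
Definition asymptotic_density (R : realType) (S : set nat) : R :=
  limn (density_seq R S).

Definition sum_pairs (H : set nat) (n : nat) : set (nat * nat) :=
  [set ab | [/\ H ab.1, H ab.2 & (ab.1 + ab.2)%N = n]].

Definition representation_count (H : set nat) (n : nat) : nat :=
  #|` fset_set (sum_pairs H n)|.

Lemma finite_initial_posnat (S : set nat) (n : nat) :
  finite_set (S `&` initial_posnat n).
Proof.
apply: (sub_finite_set _ (finite_II n.+1)) => k [_ /andP[_ kn]].
by rewrite /= ltnS.
Qed.

Lemma finite_sum_pairs (H : set nat) (n : nat) : finite_set (sum_pairs H n).
Proof.
apply: (sub_finite_set _ (finite_setX (finite_II n.+1) (finite_II n.+1))).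
by move=> [a b] [_ _ /= <-]; split; rewrite /= ltnS ?leq_addr ?leq_addl.
Qed.

(* Main.v *)
Require Import Defs.
From HB Require Import structures.
From mathcomp Require Import all_boot all_order all_algebra finmap.
From mathcomp Require Import all_classical all_reals all_analysis.
From mathcomp Require Import zify lra.
Import Order.TTheory GRing.Theory Num.Theory.
Import numFieldNormedType.Exports.

Local Open Scope classical_set_scope.
Local Open Scope ring_scope.

(** Each [k] in [0, n] satisfies [1_H(k) + 1_H(n-k) <= 1 + 1_H(k) 1_H(n-k)].
    Summing over [k], [2 #(H /\ {1..n}) <= n + 1 + r_H(n)].  The hypotheses give
    [1 - D(H) < D(H) / 2], that is [D(H) > 2/3], so that [r_H(n)] is
    eventually at least [n/3 - 1]. *)

Lemma card_fset_set_uniq (T : choiceType) (A : set T) (s : seq T) :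
  finite_set A -> uniq s -> (forall x, A x <-> x \in s) ->
  #|` fset_set A| = size s.
Proof.
move=> finA us As; apply: perm_size; apply: uniq_perm => // x.
by rewrite in_fset_set//; apply/idP/idP => [/set_mem/As//|/As/mem_set].
Qed.

(** The index 0 is kept, with a term that vanishes, so that the range agrees with that of
    [representation_countE] and the two sums can be compared term by term. *)
Lemma counting_functionE (S : set nat) (n : nat) :
  counting_function S n = (\sum_(0 <= k < n.+1) ((0 < k) && `[< S k >]))%N.
Proof.
rewrite /counting_function.
rewrite (@card_fset_set_uniq _ _
  [seq k <- index_iota 0 n.+1 | (0 < k)%N && `[< S k >]]).
- by rewrite size_filter -sum1_count big_mkcond; apply: eq_bigr => k _; case: ifP.
- exact: finite_initial_posnat.
- by rewrite filter_uniq ?iota_uniq.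
move=> k; rewrite mem_filter mem_index_iota leq0n ltnS /=; split.
  by move=> [Sk /andP[-> ->]]; rewrite andbT; exact/asboolP.
by move=> /andP[/andP[k0 /asboolP Sk] kn]; split=> //; apply/andP.
Qed.

(** A pair with sum [n] is determined by its first entry [k <= n], and for such [k] the truncated
    subtraction [n - k] is exact. *)
Lemma representation_countE (H : set nat) (n : nat) :
  representation_count H n =
  (\sum_(0 <= k < n.+1) (`[< H k >] && `[< H (n - k) >]))%N.
Proof.
rewrite /representation_count.
rewrite (@card_fset_set_uniq _ _ [seq (k, n - k)%N |
  k <- [seq k <- index_iota 0 n.+1 | `[< H k >] && `[< H (n - k)%N >]]]).
- rewrite size_map size_filter -sum1_count big_mkcond.
  by apply: eq_bigr => k _; case: ifP.
- exact: finite_sum_pairs.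
- by rewrite map_inj_uniq ?filter_uniq ?iota_uniq// => a b [].
move=> [a b]; split.
  move=> [] Ha Hb abn; apply/mapP; exists a; last by rewrite -abn addKn.
  rewrite mem_filter mem_index_iota leq0n ltnS /= -abn leq_addr addKn andbT.
  by apply/andP; split; exact/asboolP.
move=> /mapP[k]; rewrite mem_filter mem_index_iota ltnS.
move=> /andP[/andP[/asboolP Hk /asboolP Hnk] /andP[_ kn]] [-> ->].
by split=> //=; rewrite subnKC.
Qed.

Lemma counting_functionC (S : set nat) (n : nat) :
  (counting_function S n + counting_function (posnat `\` S) n)%N = n.
Proof.
(* The term at 0 vanishes for both sets; each of the other [n] indices lies in exactly one of
   them. *)
rewrite !counting_functionE -big_split /= big_nat_recl//=.
rewrite (eq_bigr (fun=> 1%N)); first by rewrite sum_nat_const_nat subn0 muln1.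
move=> k _; rewrite asbool_and asbool_neg.
have -> : `[< posnat k.+1 >] = true by apply/asboolP.
by case: `[< _ >].
Qed.

Lemma double_counting_function_le (H : set nat) (n : nat) : H `<=` posnat ->
  (2 * counting_function H n <= n.+1 + representation_count H n)%N.
Proof.
move=> Hpos; rewrite counting_functionE representation_countE.
have -> : (\sum_(0 <= k < n.+1) ((0 < k) && `[< H k >]) =
           \sum_(0 <= k < n.+1) `[< H k >])%N.
  apply: eq_bigr => -[|k] _ //=.
  by have /asboolPn/negbTE-> : ~ H 0%N by move=> /Hpos.
(* Reversing one of the two copies of the sum pairs the indicator at [k] with the one at [n - k]. *)
rewrite mul2n -addnn {2}big_nat_rev/= add0n -big_split/=.
apply: (@leq_trans (\sum_(0 <= k < n.+1)
    (1 + (`[< H k >] && `[< H (n - k) >])))%N); last first.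
  by rewrite big_split/= sum_nat_const_nat subn0 muln1.
apply: leq_sum => k _; rewrite subSS.
by case: `[< _ >]; case: `[< _ >].
Qed.

Lemma asymptotic_densityC (R : realType) (S : set nat) :
  has_asymptotic_density R S ->
  asymptotic_density R (posnat `\` S) = 1 - asymptotic_density R S.
Proof.
move=> dS; apply/cvg_lim => //.
have : (fun n => 1 - density_seq R S n) @ \oo --> 1 - asymptotic_density R S.
  by apply: cvgB => //; exact: cvg_cst.
(* The two sequences agree only for [n > 0]: at 0 the convention [0 / 0 = 0] makes one of them 0 and
   the other 1. *)
apply: cvg_trans; apply: near_eq_cvg; near=> n.
have n0 : n%:R != 0 :> R by rewrite pnatr_eq0 -lt0n; near: n; exact: nbhs_infty_gt.
rewrite /density_seq -[X in X - _](divff n0) -mulrBl; congr (_ / _).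
by rewrite -{1}(counting_functionC S n) natrD addrAC subrr add0r.
Unshelve. all: by end_near. Qed.

Theorem corollary5p4 (R : realType) (H : set nat)
    (H_pos : H `<=` posnat)
    (H_density : has_asymptotic_density R H)
    (H_density_gt0 : 0 < asymptotic_density R H)
    (HC_density_lt :
       asymptotic_density R (posnat `\` H) < 2^-1 * asymptotic_density R H) :
  representation_count H n @[n --> \oo] --> \oo.
Proof.
have d_gt : 2 / 3 < asymptotic_density R H.
  by move: HC_density_lt; rewrite asymptotic_densityC//; lra.
apply/cvgnyPge => M; near=> n.
have n0 : (0 < n)%N by near: n; exact: nbhs_infty_gt.
(* With [c] the counting function and [r] the number of representations, [2n < 3c] and
   [2c <= n + 1 + r] give [4n < 3n + 3 + 3r], that is [n < 3r + 3]; this threshold then forces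
   [M < r]. *)
have Mn : (3 * M + 3 <= n)%N by near: n; exact: nbhs_infty_ge.
have : 2 / 3 < density_seq R H n.
  by near: n; exact: (cvgr_gt _ H_density).
rewrite /density_seq ltr_pdivlMr ?ltr0n// => hn.
have {hn} : (2 * n < 3 * counting_function H n)%N.
  by rewrite -(ltr_nat R) !natrM; lra.
have := double_counting_function_le H n H_pos; lia.
Unshelve. all: by end_near. Qed.
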